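(* Let $P$ be a finite poset. Let $s$ be the number of elements of $P$ which are covered by a unique element of $P$, and let $m$ be the cardinality of $\overline{M}$, the mlb-closure of the set $M$ of maximal elements of $P$. Then $$\chi(LC(P),\lambda)=(\lambda-1)^s\,\lambda^{|P|-m-s}.$$
   Context: A closure relation on a poset $P$ is a map $H:P\to P$ such that for all $x,y\in P$: (1) $x\le H(x)$; (2) $x\le y$ implies $H(x)\le H(y)$; (3) $H(H(x))=H(x)$. $LC(P)$ is the lattice of all closure relations on $P$, ordered by $H\le K$ if and only if $H(x)\le K(x)$ for all $x\in P$; it is a ranked lattice. For $B\subseteq P$, a maximal lower bound of $B$ is a maximal element of the set $\{x\in P: x\le b \text{ for all } b\in B\}$. A subset $A\subseteq P$ is mlb-closed if for every subset $B\subseteq A$ (including $B=\emptyset$, whose maximal lower bounds are the maximal elements of $P$), all maximal lower bounds of $B$ in $P$ belong to $A$. The mlb-closure $\overline{A}$ of $A\subseteq P$ is the intersection of all mlb-closed subsets of $P$ containing $A$. For a ranked finite poset $Q$ with $\hat{0}$, $\hat{1}$ and rank function $r$ ($r(q)$ being the length of any maximal chain from $\hat{0}$ to $q$), the characteristic polynomial is $\chi(Q,\lambda)=\sum_{q\in Q}\mu(\hat{0},q)\,\lambda^{r(\hat{1})-r(q)}$, where $\mu$ is the Möbius function of $Q$. *)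

(* Defs.v *)
From HB Require Import structures.
From mathcomp Require Import all_boot all_order all_algebra.

Set Implicit Arguments.
Unset Strict Implicit.
Unset Printing Implicit Defensive.

Import Order.TTheory GRing.Theory.

Local Open Scope order_scope.

Section FinitePosets.
Context {d : Order.disp_t} {P : finPOrderType d}.
Implicit Types (x y z : P) (A B C : {set P}).

Definition covered_by x y : bool :=
  (x < y) && [forall z, ~~ ((x < z) && (z < y))].

Definition uniquely_covered : {set P} :=
  [set x | #|[set y | covered_by x y]| == 1%N].

Definition maximals A : {set P} := [set x in A | [forall y in A, ~~ (x < y)]].

Definition mlb B : {set P} := maximals [set x : P | [forall b in B, x <= b]].

Definition mlb_closed A : bool :=
  [forall B : {set P}, (B \subset A) ==> (mlb B \subset A)].

Definition mlb_closure A : {set P} :=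
  \bigcap_(C : {set P} | mlb_closed C && (A \subset C)) C.

Definition chain_between x y C : bool :=
  [&& [forall a in C, (x <= a) && (a <= y)] &
      [forall a in C, forall b in C, (a <= b) || (b <= a)]].

(* A maximal chain of the interval [x, y]; its length is #|C| - 1. *)
Definition maximal_chain x y C : bool := maxset (chain_between x y) C.

(* n is fuel: #|P| always suffices, and mobius satisfies the usual recursion  *)
(* (mobiusxx, mobiuslt, mobius0 below).                                       *)
Fixpoint mobius_rec (n : nat) x y : int :=
  if x == y then 1%R
  else if n is n'.+1 then
    if x < y then (- \sum_(z : P | ((x <= z) && (z < y))%O) mobius_rec n' x z)%R else 0%R
  else 0%R.

Definition mobius x y : int := mobius_rec #|P| x y.

End FinitePosets.

(* When Q is ranked, all the maximal chains from \bot to q have the same      *)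
(* length, and rank q is that length (rankE); LC P is ranked (LC_ranked).     *)
Definition rank {d : Order.disp_t} {Q : finTBPOrderType d} (q : Q) : nat :=
  (\max_(C : {set Q} | maximal_chain \bot q C) #|C|.-1)%N.

Definition is_ranked {d : Order.disp_t} (Q : finTBPOrderType d) : Prop :=
  forall (q : Q) (C D : {set Q}),
    maximal_chain \bot q C -> maximal_chain \bot q D -> #|C| = #|D|.

(* The subtraction is on nat; in a ranked Q, rank q <= rank \top.             *)
Definition char_poly_poset {d : Order.disp_t} (Q : finTBPOrderType d) : {poly int} :=
  (\sum_(q : Q) (mobius \bot q)%:P * 'X^(rank (\top : Q) - rank q)%N)%R.

Definition is_closure {d : Order.disp_t} {P : finPOrderType d} (H : {ffun P -> P}) : bool :=
  [&& [forall x, x <= H x],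
      [forall x, forall y, (x <= y) ==> (H x <= H y)] &
      [forall x, H (H x) == H x]].

Record LC {d : Order.disp_t} (P : finPOrderType d) : predArgType := MkLC {
  LC_fun :> {ffun P -> P};
  LC_closure : is_closure LC_fun
}.

HB.instance Definition _ (d : Order.disp_t) (P : finPOrderType d) :=
  [isSub for @LC_fun d P].
HB.instance Definition _ (d : Order.disp_t) (P : finPOrderType d) :=
  [Finite of LC P by <:].

Fact LC_display : Order.disp_t. Proof. exact: Order.Disp tt tt. Qed.

Section MobiusTheory.
Context {d : Order.disp_t} {P : finPOrderType d}.
Implicit Types (x y z : P).

Lemma mobius_rec_stable m n x y :
  (#|[set z : P | (x <= z)%O && (z < y)%O]| <= m)%N ->
  (#|[set z : P | (x <= z)%O && (z < y)%O]| <= n)%N ->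
  mobius_rec m x y = mobius_rec n x y.
Proof.
elim: m n y => [|m IHm] [|n] y //= hm hn; case: eqP => // _; case: ifP => // xy.
- by move: hm; rewrite leqn0 cards_eq0 => /eqP/setP/(_ x); rewrite !inE lexx xy.
- by move: hn; rewrite leqn0 cards_eq0 => /eqP/setP/(_ x); rewrite !inE lexx xy.
congr (- _)%R; apply: eq_bigr => z /andP[xz zy].
have lt : (#|[set w : P | (x <= w)%O && (w < z)%O]|
           < #|[set w : P | (x <= w)%O && (w < y)%O]|)%N.
  apply: proper_card; apply/properP; split.
    by apply/subsetP=> w; rewrite !inE => /andP[-> wz]; rewrite (lt_trans wz zy).
  by exists z; rewrite !inE ?xz ?zy // ltxx andbF.
by apply: IHm; rewrite -ltnS (leq_trans lt).
Qed.

Lemma mobiusxx x : mobius x x = 1%R.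
Proof. by rewrite /mobius; case: #|P| => [|n] /=; rewrite eqxx. Qed.

Lemma mobiuslt x y :
  x < y -> mobius x y = (- \sum_(z : P | ((x <= z) && (z < y))%O) mobius x z)%R.
Proof.
move=> xy; have le_card : (#|[set z : P | (x <= z)%O && (z < y)%O]| <= #|P|)%N by exact: max_card.
rewrite {1}/mobius (@mobius_rec_stable _ #|P|.+1) //=; last exact: (leq_trans le_card (leqnSn _)).
by rewrite lt_eqF // xy.
Qed.

Lemma mobius0 x y : ~~ (x <= y) -> mobius x y = 0%R.
Proof.
rewrite /mobius; case: #|P| => [|n] /= nxy; case: eqP nxy => [->|_]; rewrite ?lexx //.
by case: ifP => // /ltW ->.
Qed.

Lemma rankE {d' : Order.disp_t} (Q : finTBPOrderType d') (q : Q) (C : {set Q}) :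
  is_ranked Q -> maximal_chain \bot q C -> rank q = #|C|.-1.
Proof.
move=> rQ hC; apply/eqP; rewrite eqn_leq; apply/andP; split.
  by apply/bigmax_leqP => D hD; rewrite (rQ _ _ _ hD hC).
by rewrite /rank (bigD1 C) //= leq_maxl.
Qed.

End MobiusTheory.

Section ClosureOrder.
Context {d : Order.disp_t} {P : finPOrderType d}.
Implicit Types (H K : LC P).

Definition LC_le H K : bool := [forall x, H x <= K x].

Fact LC_le_refl : reflexive LC_le.
Proof. by move=> H; apply/forallP => x. Qed.

Fact LC_le_anti : antisymmetric LC_le.
Proof.
move=> H K /andP[/forallP HK /forallP KH]; apply/val_inj/ffunP => x /=.
by apply/le_anti; rewrite HK KH.
Qed.

Fact LC_le_trans : transitive LC_le.
Proof.
by move=> K H L /forallP HK /forallP KL; apply/forallP => x; exact: le_trans (KL x).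
Qed.

HB.instance Definition _ := Order.Le_isPOrder.Build LC_display (LC P)
  LC_le_refl LC_le_anti LC_le_trans.

End ClosureOrder.

Section ClosureLattice.
Context {d : Order.disp_t} {P : finPOrderType d}.
Implicit Types (x y z : P) (A B C : {set P}) (H K L : LC P).

Lemma LC_leE H K : (H <= K) = [forall x, H x <= K x].
Proof. by []. Qed.

Lemma LC_ext H x : x <= H x.
Proof. by case: H => H /= /and3P[/forallP]. Qed.

Lemma LC_mono H x y : x <= y -> H x <= H y.
Proof. by case: H => H /= /and3P[_ /forallP/(_ x)/forallP/(_ y)/implyP]. Qed.

Lemma LC_idem H x : H (H x) = H x.
Proof. by case: H => H /= /and3P[_ _ /forallP/(_ x)/eqP]. Qed.

Definition LC_fix H : {set P} := [set x | H x == x].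

Lemma LC_fixP H x : reflect (H x = x) (x \in LC_fix H).
Proof. by rewrite inE; exact: eqP. Qed.

Lemma LC_le_fix H K : (H <= K) = (LC_fix K \subset LC_fix H).
Proof.
rewrite LC_leE; apply/forallP/subsetP => [HK x /LC_fixP Kx | sKH x].
  by apply/LC_fixP/le_anti; rewrite LC_ext -{2}Kx HK.
have /sKH/LC_fixP <- : K x \in LC_fix K by apply/LC_fixP/LC_idem.
exact/LC_mono/LC_ext.
Qed.

Lemma mlbP B x :
  reflect ({in B, forall b, x <= b} /\
           forall y, {in B, forall b, y <= b} -> x <= y -> y = x) (x \in mlb B).
Proof.
rewrite !inE; apply: (iffP andP) => [[/forall_inP xB /forall_inP xM]|[xB xM]].
  split=> // y yB xy; apply/eqP; rewrite eq_sym; apply: contraT => nxy.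
  have := xM y; rewrite inE lt_neqAle nxy xy; apply.
  exact/forall_inP.
split; first exact/forall_inP.
apply/forall_inP => y; rewrite inE => /forall_inP yB; apply/negP => xy.
by have := xM y yB (ltW xy) => e; rewrite e ltxx in xy.
Qed.

Lemma mlb_closedP A :
  reflect (forall B, B \subset A -> mlb B \subset A) (mlb_closed A).
Proof. by apply: (iffP forallP) => h B; [apply/implyP | apply/implyP/h]. Qed.

Lemma mlb_exists B x : {in B, forall b, x <= b} -> exists2 y, y \in mlb B & x <= y.
Proof.
move=> xB; pose D := [pred y | (x <= y) && [forall b in B, y <= b]].
have Dx : D x by rewrite /= lexx; apply/forall_inP.
case: (arg_maxnP (fun y => #|[set z : P | z <= y]|) Dx) => y /andP[xy /forall_inP yB] ymax.
exists y => //; apply/mlbP; split=> // z zB yz; apply/eqP; rewrite eq_le yz andbT.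
have Dz : D z by rewrite /= (le_trans xy yz); apply/forall_inP.
have sub : [set w : P | w <= y] \subset [set w : P | w <= z].
  by apply/subsetP => w; rewrite !inE => /le_trans; apply.
have /eqP/setP/(_ z) : [set w : P | w <= y] == [set w : P | w <= z].
  by rewrite eqEcard sub; apply: ymax.
by rewrite !inE lexx.
Qed.

Lemma LC_fix_closed H : mlb_closed (LC_fix H).
Proof.
apply/mlb_closedP => B /subsetP sB; apply/subsetP => x /mlbP[xB xM].
apply/LC_fixP/xM/LC_ext => b bB; rewrite -(LC_fixP _ _ (sB b bB)).
exact/LC_mono/xB.
Qed.

Lemma mlb_closure_sub A C : mlb_closed C -> (mlb_closure A \subset C) = (A \subset C).
Proof.
move=> hC; apply/idP/idP => [|sAC]; last by apply: bigcap_inf; rewrite hC.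
apply: subset_trans; apply/bigcapsP => D /andP[] //.
Qed.

Lemma mlb_closure_closed A : mlb_closed (mlb_closure A).
Proof.
apply/mlb_closedP => B sB; apply/bigcapsP => C /andP[hC sAC].
by apply: (mlb_closedP _ hC); rewrite (subset_trans sB) // mlb_closure_sub.
Qed.

Lemma mlb_closure_id A : mlb_closed A -> mlb_closure A = A.
Proof.
move=> hA; apply/eqP; rewrite eqEsubset mlb_closure_sub // subxx /=.
by apply/bigcapsP => C /andP[].
Qed.

Lemma min_above A x : mlb_closed A ->
  exists a, (a \in A) && (x <= a) && [forall b in A, (x <= b) ==> (a <= b)].
Proof.
move=> /mlb_closedP hA; pose B := [set b in A | x <= b].
have sBA : B \subset A by apply/subsetP => b; rewrite inE => /andP[].
have [|y yB xy] := @mlb_exists B x; first by move=> b; rewrite inE => /andP[].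
exists y; rewrite (subsetP (hA _ sBA)) // xy /=.
apply/forall_inP => b bA; apply/implyP => xb.
by case/mlbP: yB => yB _; apply: yB; rewrite inE bA.
Qed.

Definition min_above_fun A : {ffun P -> P} :=
  [ffun x => odflt x
    [pick a | (a \in A) && (x <= a) && [forall b in A, (x <= b) ==> (a <= b)]]].

Lemma min_above_funP A x (a := min_above_fun A x) : mlb_closed A ->
  [/\ a \in A, x <= a & forall b, b \in A -> x <= b -> a <= b].
Proof.
move=> hA; rewrite /a ffunE; case: pickP => [c /andP[/andP[cA xc] /forall_inP cM]|no] /=.
  by split=> // b /cM/implyP.
by have [c] := min_above x hA; rewrite no.
Qed.

Fact min_above_closure A : is_closure (min_above_fun (mlb_closure A)).
Proof.
have hA := mlb_closure_closed A; apply/and3P; split.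
- by apply/forallP => x; case: (min_above_funP x hA).
- apply/forallP => x; apply/forallP => y; apply/implyP => xy.
  case: (min_above_funP x hA) => _ _; apply; case: (min_above_funP y hA) => // _ yy _.
  exact: le_trans yy.
- apply/forallP => x; rewrite eq_le.
  case: (min_above_funP x hA) => xA _ _.
  by case: (min_above_funP (min_above_fun (mlb_closure A) x) hA) => _ -> ->.
Qed.

Definition LC_of_set A : LC P := MkLC (min_above_closure A).

Lemma LC_fix_of_set A : LC_fix (LC_of_set A) = mlb_closure A.
Proof.
have hA := mlb_closure_closed A; apply/setP => x; apply/LC_fixP/idP => [<-|xA] /=.
  by case: (min_above_funP x hA).
by case: (min_above_funP x hA) => _ le ge; apply/le_anti; rewrite le ge.
Qed.

Lemma LC_le_of_set H A : (H <= LC_of_set A) = (A \subset LC_fix H).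
Proof. by rewrite LC_le_fix LC_fix_of_set mlb_closure_sub ?LC_fix_closed. Qed.

Lemma LC_of_set_le H A : mlb_closed A -> (LC_of_set A <= H) = (LC_fix H \subset A).
Proof. by move=> hA; rewrite LC_le_fix LC_fix_of_set mlb_closure_id. Qed.

Definition LC_meet H K : LC P := LC_of_set (LC_fix H :|: LC_fix K).
Definition LC_join H K : LC P := LC_of_set (LC_fix H :&: LC_fix K).

Fact LC_lexI H K L : (H <= LC_meet K L) = (H <= K) && (H <= L).
Proof. by rewrite LC_le_of_set subUset -!LC_le_fix. Qed.

Lemma mlb_closedI A B : mlb_closed A -> mlb_closed B -> mlb_closed (A :&: B).
Proof.
move=> /mlb_closedP hA /mlb_closedP hB; apply/mlb_closedP => C.
by rewrite !subsetI => /andP[/hA -> /hB ->].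
Qed.

Fact LC_leUx H K L : (LC_join H K <= L) = (H <= L) && (K <= L).
Proof.
by rewrite LC_of_set_le ?mlb_closedI ?LC_fix_closed // subsetI -!LC_le_fix.
Qed.

Fact LC_id_closure : is_closure [ffun x : P => x].
Proof.
apply/and3P; split; apply/forallP => x; rewrite ?ffunE //.
by apply/forallP => y; rewrite !ffunE; apply/implyP.
Qed.

Fact LC_le0x H : MkLC LC_id_closure <= H.
Proof. by rewrite LC_leE; apply/forallP => x; rewrite ffunE LC_ext. Qed.

Fact LC_lex1 H : H <= LC_of_set set0.
Proof. by rewrite LC_le_of_set sub0set. Qed.

HB.instance Definition _ :=
  Order.POrder_isMeetSemilattice.Build LC_display (LC P) LC_lexI.
HB.instance Definition _ :=
  Order.POrder_isJoinSemilattice.Build LC_display (LC P) LC_leUx.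
HB.instance Definition _ := Order.hasBottom.Build LC_display (LC P) LC_le0x.
HB.instance Definition _ := Order.hasTop.Build LC_display (LC P) LC_lex1.

End ClosureLattice.

Section UniquelyCovered.
Context {d : Order.disp_t} {P : finPOrderType d}.
Implicit Types (x y : P).

Lemma covered_by_exists x y : x < y -> exists2 z, covered_by x z & z <= y.
Proof.
move=> xy; pose D := [pred z | (x < z) && (z <= y)].
have Dy : D y by rewrite /= xy lexx.
case: (arg_minnP (fun z => #|[set w : P | w <= z]|) Dy) => z /andP[xz zy] zmin.
exists z => //; rewrite /covered_by xz; apply/forallP => w; apply/negP => /andP[xw wz].
have /zmin : D w by rewrite /= xw (le_trans (ltW wz)).
rewrite leqNgt => /negP; apply; apply: proper_card; apply/properP; split.
  by apply/subsetP => v; rewrite !inE => /le_trans; apply; apply: ltW.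
by exists z; rewrite !inE ?lexx // lt_geF.
Qed.

(* So the truncated difference of these three cardinals is the exact one.     *)
Lemma card_mlb_closure_uniquely_covered :
  (#|mlb_closure (maximals [set: P])| + #|@uniquely_covered d P| <= #|P|)%N.
Proof.
have hS : mlb_closed (~: @uniquely_covered d P).
  apply/mlb_closedP => B /subsetP sB; apply/subsetP => x /mlbP[xB xM].
  rewrite !inE; apply/negP => /cards1P[z ez].
  have /andP[xz _] : covered_by x z by have := set11 z; rewrite -ez inE.
  suff zx : z = x by rewrite zx ltxx in xz.
  apply: xM (ltW xz) => b bB.
  have xb : x < b.
    rewrite lt_neqAle xB // andbT; apply/eqP => e; have := sB _ bB.
    by rewrite -e !inE ez cards1.
  have [w xw wb] := covered_by_exists xb.
  by have : w \in [set z] by [rewrite -ez inE]; rewrite inE => /eqP <-.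
have sM : mlb_closure (maximals [set: P]) \subset ~: @uniquely_covered d P.
  rewrite mlb_closure_sub //; suff -> : maximals [set: P] = mlb set0.
    exact: (mlb_closedP _ hS _ (sub0set _)).
  congr maximals; apply/setP => x; rewrite !inE; symmetry; apply/forall_inP => b.
  by rewrite inE.
by rewrite -(cardsC (@uniquely_covered d P)) addnC leq_add2l subset_leq_card.
Qed.

End UniquelyCovered.

Section ClosureRanked.
Context {d : Order.disp_t} {P : finPOrderType d}.
Implicit Types (x y : P) (H K L p q : LC P) (C D : {set LC P}).

Lemma LC_lt_fix H K : (H < K) = (LC_fix K \proper LC_fix H).
Proof. by rewrite lt_leAnge !LC_le_fix properE. Qed.

Lemma LC_fix_bot : LC_fix (\bot : LC P) = setT.
Proof. by apply/setP => x; rewrite !inE ffunE eqxx. Qed.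

Lemma LC_next H K : H < K ->
  exists2 L, H <= L & L < K /\ #|LC_fix L| = #|LC_fix K|.+1.
Proof.
rewrite LC_lt_fix => /properP[sKH [x0 x0H x0K]].
pose D := [pred x | (x \in LC_fix H) && (x \notin LC_fix K)].
have Dx0 : D x0 by rewrite /= x0H x0K.
case: (arg_minnP (fun x => #|[set z : P | z <= x]|) Dx0) => x /andP[xH xK] xmin.
have hA : mlb_closed (x |: LC_fix K).
  apply/mlb_closedP => B sB; apply/subsetP => y yB.
  have sBH : B \subset LC_fix H.
    apply: subset_trans sB _; apply/subsetP => z; rewrite in_setU1.
    by case/predU1P=> [-> //|]; exact: (subsetP sKH).
  have yH := subsetP (mlb_closedP _ (LC_fix_closed H) _ sBH) _ yB.
  rewrite in_setU1; have [xB|xB] := boolP (x \in B).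
    have yx : y <= x by case/mlbP: yB => yB _; apply: yB.
    case: eqVneq => //= nyx; apply: contraT => yK.
    have Dy : D y by rewrite /= yH yK.
    suff : (#|[set z : P | (z <= y)%O]| < #|[set z : P | (z <= x)%O]|)%N.
      by rewrite ltnNge xmin.
    apply: proper_card; apply/properP; split.
      by apply/subsetP => z; rewrite !inE => /le_trans; apply.
    exists x; rewrite !inE ?lexx //; apply/negP => xy.
    by case/eqP: nyx; apply/le_anti; rewrite xy yx.
  have sBK : B \subset LC_fix K.
    apply/subsetP => z zB; have := subsetP sB _ zB; rewrite in_setU1.
    by case/predU1P=> [zx|//]; rewrite -zx zB in xB.
  by rewrite (subsetP (mlb_closedP _ (LC_fix_closed K) _ sBK)) ?orbT.
exists (LC_of_set (x |: LC_fix K)).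
  by rewrite LC_le_fix LC_fix_of_set mlb_closure_id // subUset sub1set xH sKH.
rewrite LC_lt_fix LC_fix_of_set mlb_closure_id // cardsU1 xK; split=> //.
by apply: properUr; rewrite sub1set.
Qed.

Lemma chain_betweenP H K C :
  reflect ((forall a, a \in C -> H <= a <= K) /\
           (forall a b, a \in C -> b \in C -> (a <= b) || (b <= a)))
          (chain_between H K C).
Proof.
apply: (iffP andP) => [[/forall_inP h1 /forall_inP h2]|[h1 h2]]; split.
- exact: h1.
- by move=> a b /h2 /forall_inP; apply.
- exact/forall_inP.
- by apply/forall_inP => a aC; apply/forall_inP => b bC; apply: h2.
Qed.

Lemma maximal_chain_add H K C L : maximal_chain H K C -> H <= L <= K ->
  (forall a, a \in C -> (a <= L) || (L <= a)) -> L \in C.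
Proof.
case/maxsetP => /chain_betweenP[h1 h2] hmax hL hLC.
rewrite -(hmax (L |: C)) ?setU11 ?subsetU1 //.
apply/chain_betweenP; split=> [a|a b]; first by case/setU1P => [->|/h1].
case/setU1P=> [->|aC]; case/setU1P=> [->|bC]; rewrite ?lexx //.
- by rewrite orbC hLC.
- exact: hLC.
- exact: h2.
Qed.

Lemma card_maximal_chain q C :
  maximal_chain \bot q C -> (#|C| + #|LC_fix q|)%N = #|P|.+1.
Proof.
have [n] := ubnP (#|P| - #|LC_fix q|); elim: n q C => // n IHn q C hn hC.
have /chain_betweenP[h1 h2] := maxsetp hC.
have qC : q \in C.
  by apply: (maximal_chain_add hC); rewrite ?le0x ?lexx // => a /h1/andP[_ ->].
have botC : \bot \in C.
  apply: (maximal_chain_add hC) => [|a _]; by rewrite ?le0x ?lexx ?orbT.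
have [q0|qn0] := eqVneq q \bot.
  suff -> : C = [set \bot] by rewrite cards1 q0 LC_fix_bot cardsT.
  apply/setP => a; rewrite inE; apply/idP/eqP => [/h1|-> //].
  by rewrite q0 => aC; apply/le_anti; rewrite andbC.
have Dbot : [pred a in C | a != q] \bot by rewrite /= botC eq_sym.
case: (arg_minnP (fun a => #|LC_fix a|) Dbot) => p /andP[pC pq] pmin.
have lepq : p <= q by case/andP: (h1 _ pC).
have lep a : a \in C -> a != q -> a <= p.
  move=> aC aq; case/orP: (h2 _ _ aC pC) => // pa.
  have /eqP : LC_fix a == LC_fix p.
    by rewrite eqEcard -LC_le_fix pa; apply: pmin; rewrite /= aC aq.
  by move=> e; rewrite LC_le_fix e.
have ltpq : p < q by rewrite lt_neqAle pq.
have [L pL [Lq cL]] := LC_next ltpq.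
have LC : L \in C.
  apply: (maximal_chain_add hC) => [|a aC]; first by rewrite le0x ltW.
  have [->|aq] := eqVneq a q; first by rewrite (ltW Lq) orbT.
  by rewrite (le_trans (lep _ aC aq)).
have eLp : L = p by apply/le_anti; rewrite pL lep // lt_eqF.
have {}cL : #|LC_fix p| = #|LC_fix q|.+1 by rewrite -eLp.
have cp : (#|LC_fix p| <= #|P|)%N by exact: max_card.
have hCq : maximal_chain \bot p (C :\ q).
  apply/maxsetP; split=> [|D /chain_betweenP[g1 g2] sCD].
    apply/chain_betweenP; split=> [a|a b].
      by case/setD1P=> aq aC; rewrite le0x lep.
    by case/setD1P=> _ aC /setD1P[_ bC]; apply: h2.
  have qD : q \notin D.
    by apply/negP => /g1/andP[_]; rewrite lt_geF.
  have /maxsetP[_ hmax] := hC.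
  rewrite -(hmax (q |: D)) ?setU1K //.
    have lq a : a \in D -> a <= q by case/g1/andP => _ /le_trans; apply.
    apply/chain_betweenP; split=> [a|a b].
      by case/setU1P=> [->|/lq ->]; rewrite ?le0x ?lexx.
    case/setU1P=> [->|aD]; case/setU1P=> [->|bD]; rewrite ?lexx //.
    - by rewrite lq ?orbT.
    - by rewrite lq.
    - exact: g2.
  by rewrite -(setD1K qC) setUS.
have lt_n : (#|P| - #|LC_fix p| < n)%N.
  by move: hn; rewrite ltnS; apply: leq_trans; rewrite ltn_sub2l // -cL.
by rewrite -(IHn _ _ lt_n hCq) cL (cardsD1 q C) qC addnS.
Qed.

Lemma LC_ranked : is_ranked (LC P).
Proof.
move=> q C D /card_maximal_chain hC /card_maximal_chain hD.
by apply/eqP; rewrite -(eqn_add2r #|LC_fix q|) hC hD.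
Qed.

End ClosureRanked.

(* Main.v *)
Require Import Defs.
From mathcomp Require Import all_boot all_order all_algebra.

Set Implicit Arguments.
Unset Strict Implicit.
Unset Printing Implicit Defensive.

Import Order.TTheory GRing.Theory.
Local Open Scope ring_scope.

(** A closure relation [H] is determined by its fixed points, which form an
    mlb-closed set, and [H <= K] iff the fixed points of [K] are among those of
    [H]; moreover [H] has rank [#|P| - #|LC_fix H|].  So the coatoms of the
    lattice of mlb-closed sets are the atoms of [LC P], and everything follows
    from locating them in terms of the set [S] of uniquely covered elements.

    An element [x] of [S] is not a maximal lower bound of any set that misses
    [x], because the unique cover of [x] bounds every such set from below as
    soon as [x] does.  Hence the complement of any [T \subset S] is mlb-closed
    ([mlb_closed_setC]).  On the other hand an element outside [S] is a maximal
    lower bound of the elements strictly above it, so that, going down in [P],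
    [S] generates the whole of [P] ([mlb_closed_uniquely_coveredT]).  The atoms
    of [LC P] thus correspond to the elements of [S], and the sets [T \subset S]
    have pairwise distinct joins, with fixed points [~: T].

    By Rota's cross-cut theorem, [mobius \bot H] is then [(-1) ^+ #|T|] when
    [H] moves exactly the elements of some [T \subset S], and vanishes for all
    other [H] ([mobius_LC]).  This is verified here through the recursion that
    defines the Moebius function: the sum of these values below [H] runs over
    the subsets of [S :\: LC_fix H], and is [0 ^+ #|S :\: LC_fix H|] by the
    binomial formula; it vanishes unless [LC_fix H] contains [S], that is,
    unless [H] is [\bot].  The characteristic polynomial is finally the sum of
    [(-1) ^+ #|T| * 'X^(#|P| - m - #|T|)] over [T \subset S], to which the
    binomial formula applies once more. *)

Lemma exprDn_subset (R : comNzRingType) (T : finType) (A : {set T}) (a b : R) :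
  (a + b) ^+ #|A| = \sum_(B : {set T} | B \subset A) a ^+ #|B| * b ^+ (#|A| - #|B|).
Proof.
pose card B : 'I_#|A|.+1 := inord #|B : {set T}|.
rewrite addrC exprDn (partition_big card xpredT) //=.
apply: eq_bigr => i _; rewrite -cards_draws -sumr_const.
apply: congr_big => // [B|B].
  rewrite inE; apply: andb_id2l => /subset_leq_card sBA.
  by rewrite -val_eqE /= inordK.
by rewrite inE => /andP[_ /eqP ->]; rewrite mulrC.
Qed.

Lemma sum_sign_subset (T : finType) (A : {set T}) :
  \sum_(B : {set T} | B \subset A) (-1) ^+ #|B| = 0 ^+ #|A| :> int.
Proof.
rewrite -(addNr 1) exprDn_subset; apply: eq_bigr => B _.
by rewrite expr1n mulr1.
Qed.

Lemma mobius_unique (d : Order.disp_t) (P : finPOrderType d) (x : P) (g : P -> int) :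
    g x = 1 ->
    (forall y, (x < y)%O -> \sum_(z | (x <= z <= y)%O) g z = 0) ->
  forall y, (x <= y)%O -> mobius x y = g y.
Proof.
move=> gx gsum y; have [n] := ubnP #|[set z : P | (z < y)%O]|.
elim: n y => // n IHn y hn; rewrite le_eqVlt => /predU1P[<-|xy].
  by rewrite mobiusxx.
rewrite mobiuslt //; apply/esym/eqP; rewrite -subr_eq0 opprK.
have := gsum y xy; rewrite (bigD1 y) /= ?lexx ?(ltW xy) // => e.
rewrite -[X in _ == X]e; apply/eqP; congr (_ + _).
apply: eq_big => [z|z /andP[xz zy]].
  by rewrite [(z < y)%O]lt_neqAle; case: (x <= z)%O; rewrite //= andbC.
apply: IHn => //; rewrite -ltnS; apply: leq_trans hn; rewrite ltnS.
apply: proper_card; apply/properP; split.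
  by apply/subsetP => w; rewrite !inE => /lt_trans; apply.
by exists z; rewrite !inE ?ltxx.
Qed.

Section ClosureRelations.
Context {d : Order.disp_t} {P : finPOrderType d}.
Implicit Types (x y z : P) (A T : {set P}) (H K : LC P).

Local Notation S := (@uniquely_covered d P).

Lemma uniquely_coveredP x :
  reflect (exists2 z, (x < z)%O & forall y, (x < y)%O -> (z <= y)%O) (x \in S).
Proof.
rewrite inE; apply: (iffP cards1P) => [[z ez]|[z xz zmin]].
  have cov w : covered_by x w = (w == z) by rewrite -in_set1 -ez inE.
  have /andP[xz _] : covered_by x z by rewrite cov.
  by exists z => // y /covered_by_exists[w]; rewrite cov => /eqP ->.
exists z; apply/setP => w; rewrite !inE; apply/andP/eqP => [[xw /forallP/(_ z)]|->].
  by rewrite xz /= lt_neqAle zmin // andbT negbK => /eqP.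
split=> //; apply/forallP => y; apply/negP => /andP[/zmin zy yz].
by have := le_lt_trans zy yz; rewrite ltxx.
Qed.

(** The unique cover [z] of some [x \in T] lies below every [b] above [x] other
    than [x] itself, so it shows that [x] is not a maximal lower bound of a set
    that avoids [T]. *)
Lemma mlb_closed_setC T : T \subset S -> mlb_closed (~: T).
Proof.
move=> /subsetP sTS; apply/mlb_closedP => B /subsetP sB.
apply/subsetP => x /mlbP[xB xM]; rewrite inE; apply/negP => xT.
have /uniquely_coveredP[z xz zmin] := sTS _ xT.
suff zx : z = x by rewrite zx ltxx in xz.
apply: xM (ltW xz) => b bB; apply: zmin; rewrite lt_neqAle xB // andbT.
by apply: contraTneq xT => ->; have := sB _ bB; rewrite inE.
Qed.

(** If some element were missing from [A], a maximal missing [x] would be a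
    maximal lower bound of the elements strictly above it, all in [A]: a larger
    lower bound would be the unique cover of [x], although [x] is outside [S]. *)
Lemma mlb_closed_uniquely_coveredT A : mlb_closed A -> S \subset A -> A = setT.
Proof.
move=> /mlb_closedP hA /subsetP sSA; apply/eqP; rewrite eqEsubset subsetT /=.
apply/subsetP => x _.
have [n] := ubnP #|[set y : P | (x < y)%O]|; elim: n x => // n IHn x hn.
have [/sSA //|xS] := boolP (x \in S).
pose B := [set y : P | (x < y)%O].
have sBA : B \subset A.
  apply/subsetP => y; rewrite inE => xy; apply: IHn.
  rewrite -ltnS; apply: leq_trans hn; rewrite ltnS; apply: proper_card.
  apply/properP; split; last by exists y; rewrite !inE ?ltxx.
  by apply/subsetP => z; rewrite !inE; apply: lt_trans.
apply: (subsetP (hA _ sBA)); apply/mlbP; split=> [b|y yB xy].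
  by rewrite inE => /ltW.
apply/eqP; apply: contraNT xS => nyx; apply/uniquely_coveredP.
exists y => [|z xz]; first by rewrite lt_neqAle eq_sym nyx.
by apply: yB; rewrite inE.
Qed.

(** Closure relations that move exactly the elements of a given [T \subset S]
    exist and are unique, so such sums can be indexed by the subsets. *)
Lemma sum_LC_subset (R : nmodType) A (F : nat -> R) : A \subset S ->
  \sum_(H : LC P | ~: LC_fix H \subset A) F #|~: LC_fix H| =
  \sum_(T : {set P} | T \subset A) F #|T|.
Proof.
move=> sAS.
rewrite (reindex_onto (fun T : {set P} => LC_of_set (~: T)) (fun H => ~: LC_fix H)).
  have fixT T : T \subset A -> ~: LC_fix (LC_of_set (~: T)) = T.
    move=> sTA; rewrite LC_fix_of_set mlb_closure_id ?setCK //.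
    exact/mlb_closed_setC/(subset_trans sTA).
  apply: eq_big => [T|T /andP[_ /eqP -> //]].
  apply/andP/idP => [[sA /eqP e]|sTA]; first by rewrite -e.
  by rewrite fixT.
move=> H _; apply/eqP; rewrite eq_le !LC_le_fix setCK LC_fix_of_set.
by rewrite mlb_closure_id ?subxx ?LC_fix_closed.
Qed.

Lemma mobius_LC H : mobius \bot%O H =
  if ~: LC_fix H \subset S then (-1) ^+ #|~: LC_fix H| else 0.
Proof.
pose g K : int := if ~: LC_fix K \subset S then (-1) ^+ #|~: LC_fix K| else 0.
apply: (@mobius_unique _ _ _ g) => [|K|]; last exact: le0x.
  by rewrite /g LC_fix_bot setCT sub0set cards0.
move=> ltK; rewrite -big_mkcondr /=.
under eq_bigl => L.
  (* L <= K means that L moves only elements moved by K *)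
  rewrite le0x /= LC_le_fix -setCS andbC -subsetI; over.
rewrite (sum_LC_subset (fun n => (-1) ^+ n)) ?subsetIl // sum_sign_subset.
apply/eqP; rewrite expf_eq0 eqxx andbT card_gt0; apply/negP => /eqP e.
have fixK : LC_fix K = setT.
  apply: mlb_closed_uniquely_coveredT; first exact: LC_fix_closed.
  by rewrite -setD_eq0 setDE e.
by move: ltK; rewrite LC_lt_fix fixK LC_fix_bot properxx.
Qed.

Lemma rank_LC H : rank H = #|~: LC_fix H|.
Proof.
have [|C hC] := @ex_maxset _ (chain_between \bot%O H).
  by exists set0; apply/chain_betweenP; split=> [a|a b]; rewrite inE.
have := card_maximal_chain hC; have := cardsC (LC_fix H).
rewrite (rankE (@LC_ranked _ _) hC) => <- /eqP.
by rewrite addnC -addnS eqn_add2l => /eqP ->.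
Qed.

(** The maximal elements are the maximal lower bounds of the empty set, so they
    lie in every mlb-closed set. *)
Lemma LC_fix_top : LC_fix (\top%O : LC P) = mlb_closure (maximals [set: P]).
Proof.
apply/eqP; rewrite eqEsubset mlb_closure_sub ?LC_fix_closed //; apply/andP; split.
  rewrite LC_fix_of_set mlb_closure_sub ?sub0set //.
  exact: mlb_closure_closed.
suff -> : maximals [set: P] = mlb set0.
  exact: (mlb_closedP _ (LC_fix_closed _) _ (sub0set _)).
congr maximals; apply/setP => x; rewrite !inE; symmetry.
by apply/forall_inP => b; rewrite inE.
Qed.

End ClosureRelations.

Theorem corollary8 (d : Order.disp_t) (P : finPOrderType d) :
  let s := #|@uniquely_covered d P| in
  let m := #|mlb_closure (maximals [set: P])| in
  char_poly_poset (LC P) = ('X - 1) ^+ s * 'X^(#|P| - m - s)%N.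
Proof.
move=> s m; pose F k : {poly int} := (-1) ^+ k * 'X^(#|P| - m - k).
transitivity (\sum_(H : LC P | ~: LC_fix H \subset uniquely_covered)
                F #|~: LC_fix H|).
  rewrite big_mkcond; apply: eq_bigr => H _.
  rewrite mobius_LC !rank_LC LC_fix_top [#|~: mlb_closure _|]cardsCs setCK.
  by case: ifP => _; rewrite ?mul0r // rmorphXn rmorphN1.
rewrite (sum_LC_subset F) // addrC exprDn_subset mulr_suml.
apply: eq_bigr => T /subset_leq_card lts; rewrite /F -mulrA -exprD.
have ms : (s <= #|P| - m)%N.
  by rewrite leq_subRL ?max_card // card_mlb_closure_uniquely_covered.
by rewrite [(_ - _ + _)%N]addnC addnBA // subnK.
Qed.
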